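(* Let $m\in\mathbb{N}$, let $K_1,\dots,K_m$ be (nonempty) compact Hausdorff topological spaces, let $H_i$ be a closed subspace of $C(K_i)$ for $i\in\{1,\dots,m\}$, let $F$ be a Banach space and $1\le p<\infty$. A continuous $m$-linear operator $u:H_1\times\dots\times H_m\to F$ is Lipschitz $p$-semi-integral if and only if there are a constant $C>0$ and a regular Borel probability measure $\nu$ on $K_1\times\dots\times K_m$, endowed with the product topology, such that for all $(T_1,\dots,T_m),(S_1,\dots,S_m)\in H_1\times\dots\times H_m$, $$\|u(T_1,\dots,T_m)-u(S_1,\dots,S_m)\|_F\le C\left(\int_{K_1\times\dots\times K_m}|T_1(\varphi_1)\cdots T_m(\varphi_m)-S_1(\varphi_1)\cdots S_m(\varphi_m)|^p\,d\nu(\varphi)\right)^{1/p},$$ where $\varphi=(\varphi_1,\dots,\varphi_m)$.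
   Context: All Banach spaces are over the same scalar field $\mathbb{K}=\mathbb{R}$ or $\mathbb{C}$; $C(K)$ is the Banach space of continuous functions $K\to\mathbb{K}$ with the sup norm; $B_{E^*}$ is the closed unit ball of the dual of $E$. For Banach spaces $E_1,\dots,E_m,F$ and $1\le p<\infty$, a continuous $m$-linear operator $u:E_1\times\dots\times E_m\to F$ is Lipschitz $p$-semi-integral if there is a constant $C>0$ such that for all $n\in\mathbb{N}$ and all $(x_{1,j},\dots,x_{m,j}),(q_{1,j},\dots,q_{m,j})\in E_1\times\dots\times E_m$, $j\in\{1,\dots,n\}$, $$\left(\sum_{j=1}^n\|u(x_{1,j},\dots,x_{m,j})-u(q_{1,j},\dots,q_{m,j})\|_F^p\right)^{1/p}\le C\sup_{(\alpha_1,\dots,\alpha_m)\in B_{E_1^*}\times\dots\times B_{E_m^*}}\left(\sum_{j=1}^n|\alpha_1(x_{1,j})\cdots\alpha_m(x_{m,j})-\alpha_1(q_{1,j})\cdots\alpha_m(q_{m,j})|^p\right)^{1/p}.$$ *)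

(* Defs.v *)
From HB Require Import structures.
From mathcomp Require Import all_boot all_order all_algebra.
From mathcomp Require Import complex.
From mathcomp Require Import all_classical all_reals all_analysis.

Set Implicit Arguments.
Unset Strict Implicit.
Unset Printing Implicit Defensive.

Import Order.TTheory GRing.Theory Num.Theory.
Import numFieldNormedType.Exports.

Local Open Scope classical_set_scope.
Local Open Scope ring_scope.

(* The scalar field is R or R[i]; norms of [normedModType (scalars R s)] are
   scalars, and [re] turns them into reals. *)
Variant scalar_kind := RealScalars | ComplexScalars.

Definition scalars (R : realType) (s : scalar_kind) : numFieldType :=
  match s with RealScalars => R | ComplexScalars => R[i] end.

Definition re (R : realType) (s : scalar_kind) : scalars R s -> R :=
  match s with RealScalars => id | ComplexScalars => @complex.Re R end.

Definition of_real (R : realType) (s : scalar_kind) : R -> scalars R s :=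
  match s with RealScalars => id | ComplexScalars => real_complex R end.

Section scalars_theory.
Context (R : realType) (s : scalar_kind).
Implicit Types (a b : R) (x y : scalars R s).

Lemma reK x : 0 <= x -> of_real s (re x) = x.
Proof.
case: s x => [|] //= [a b]; rewrite lecE /= => /andP[/eqP -> _].
by [].
Qed.

Lemma of_realK a : re (of_real s a) = a.
Proof. by case: s. Qed.

Lemma of_real0 : of_real s 0 = 0 :> scalars R s.
Proof. by case: s. Qed.

Lemma of_realD a b : of_real s (a + b) = of_real s a + of_real s b.
Proof. by case: s => //=; rewrite rmorphD. Qed.

Lemma of_realM a b : of_real s (a * b) = of_real s a * of_real s b.
Proof. by case: s => //=; rewrite rmorphM. Qed.

Lemma ler_of_real a b : (of_real s a <= of_real s b) = (a <= b).
Proof. by case: s => //=; rewrite lecR. Qed.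

Lemma ltr_of_real a b : (of_real s a < of_real s b) = (a < b).
Proof. by case: s => //=; rewrite ltcR. Qed.

Lemma re_normD (V : normedZmodType (scalars R s)) (v w : V) :
  re `|v + w| <= re `|v| + re `|w|.
Proof. by rewrite -ler_of_real of_realD !reK// ler_normD. Qed.

Lemma re_normM x y : re `|x * y| = re `|x| * re `|y|.
Proof. by rewrite -[RHS]of_realK of_realM !reK// -normrM. Qed.

Lemma re_norm_ge0 (V : normedZmodType (scalars R s)) (v : V) : 0 <= re `|v|.
Proof.
by rewrite -ler_of_real reK// of_real0.
Qed.

Lemma re_norm_eq0 x : re `|x| = 0 -> x = 0.
Proof.
move=> x0; apply/normr0_eq0; rewrite -(reK (normr_ge0 x)) x0.
by case: s.
Qed.

Lemma continuous_re_norm :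
  continuous (fun x : scalars R s => re `|x|).
Proof.
move=> x; have FF := @nbhs_filter (scalars R s) x.
apply/(@cvgrPdist_lt _ R _ _ FF) => e e0.
have e0' : 0 < of_real s e by rewrite -of_real0 ltr_of_real.
have nx : \forall y \near x, `|x - y| < of_real s e.
  by apply/nbhs_ballP; exists (of_real s e).
apply: filterS nx => y xy; apply: (@le_lt_trans _ _ (re `|x - y|)).
  rewrite ler_norml; apply/andP; split.
    rewrite lerNl opprB lerBlDr -(distrC y x).
    by rewrite -[in leLHS](subrK x y) re_normD.
  by rewrite lerBlDr -[in leLHS](subrK y x) re_normD.
by rewrite -ltr_of_real reK.
Qed.

End scalars_theory.

HB.mixin Record isCompactHausdorff T & Topological T := {
  compact_space : compact [set: T] ;
  hausdorff_compact : hausdorff_space T }.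

(* Pointed, hence nonempty. *)
#[short(type="compactHausdorffType")]
HB.structure Definition CompactHausdorff :=
  {T of Topological T & isPointed T & isCompactHausdorff T}.

Section continuous_functions.
Context (R : realType) (s : scalar_kind) (K : compactHausdorffType).

Definition continuous_pred : {pred (K -> scalars R s)} :=
  mem [set f : K -> scalars R s | continuous f].

Lemma continuous_pred_submod : submod_closed continuous_pred.
Proof.
split; first by rewrite inE /=; exact: cst_continuous.
move=> a f g; rewrite !inE /= => cf cg x.
by apply: cvgD; [apply: cvgZr; exact: cf|exact: cg].
Qed.

HB.instance Definition _ :=
  GRing.isSubmodClosed.Build _ _ continuous_pred continuous_pred_submod.

Record cfun := Cfun {
  cfun_fun :> K -> scalars R s ;
  cfun_continuous : cfun_fun \in continuous_pred }.

HB.instance Definition _ := [isSub for cfun_fun].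
HB.instance Definition _ := [Choice of cfun by <:].
HB.instance Definition _ := [SubChoice_isSubLmodule of cfun by <:].

Definition sup_norm (f : cfun) : scalars R s :=
  of_real s (sup [set re `|f x| | x in [set: K]]).

Lemma has_sup_cfun (f : cfun) : has_sup [set re `|f x| | x in [set: K]].
Proof.
split; first by exists (re `|f point|), point.
have cf : continuous (f : K -> scalars R s).
  by have := cfun_continuous f; rewrite inE.
have : compact ((fun x => re `|f x|) @` [set: K]).
  apply: continuous_compact; last exact: compact_space.
  apply: continuous_subspaceT => x.
  exact: (continuous_comp (cf x) (@continuous_re_norm R s (f x))).
move=> /compact_bounded[M [_ /(_ (M + 1))]]; rewrite ltrDl ltr01 => /(_ isT) fM.
by exists (M + 1) => y fy; rewrite (le_trans (ler_norm _))// fM.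
Qed.

Lemma sup_norm_ub (f : cfun) x :
  re `|f x| <= sup [set re `|f x| | x in [set: K]].
Proof. by apply: ub_le_sup; [case: (has_sup_cfun f)|exists x]. Qed.

Lemma ler_sup_normD (f g : cfun) :
  sup_norm (f + g) <= sup_norm f + sup_norm g.
Proof.
rewrite /sup_norm -of_realD ler_of_real; apply: ge_sup.
  by case: (has_sup_cfun (f + g)).
move=> _ [x _ <-]; apply: le_trans (re_normD _ _) _.
by apply: lerD; exact: sup_norm_ub.
Qed.

Let sup_norm_ge0 (f : cfun) : 0 <= sup_norm f.
Proof.
rewrite -(of_real0 R s) ler_of_real.
exact: le_trans (re_norm_ge0 (f point)) (sup_norm_ub f point).
Qed.

Let ler_sup_normZ (a : scalars R s) (f : cfun) :
  sup_norm (a *: f) <= `|a| * sup_norm f.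
Proof.
rewrite -{1}(reK (normr_ge0 a)) -of_realM ler_of_real; apply: ge_sup.
  by case: (has_sup_cfun (a *: f)).
move=> _ [x _ <-]; rewrite re_normM.
by apply: ler_wpM2l; [exact: re_norm_ge0|exact: sup_norm_ub].
Qed.

Lemma sup_normZ (a : scalars R s) (f : cfun) :
  sup_norm (a *: f) = `|a| * sup_norm f.
Proof.
apply/eqP; rewrite eq_le ler_sup_normZ /=.
have [->|a0] := eqVneq a 0; first by rewrite normr0 mul0r.
rewrite -ler_pdivlMl ?normr_gt0// -normfV.
by apply: le_trans (ler_sup_normZ _ _); rewrite scalerA mulVf// scale1r.
Qed.

Lemma sup_norm_eq0 (f : cfun) : sup_norm f = 0 -> f = 0.
Proof.
move=> f0; apply/val_inj/funext => x /=; apply/re_norm_eq0/eqP.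
rewrite eq_le re_norm_ge0 andbT (le_trans (sup_norm_ub f x))//.
by rewrite -(ler_of_real s) -/(sup_norm f) f0 of_real0.
Qed.

HB.instance Definition _ := Lmodule_isNormed.Build (scalars R s) cfun
  ler_sup_normD sup_normZ sup_norm_eq0.

End continuous_functions.

Section linear_subspace.
Context (K : numFieldType) (V : normedModType K) (H : submodClosed V).

(* The subspace H of V as a normed space, with the norm induced by V. *)
Record subvec := Subvec { subvec_val : V ; subvec_in : subvec_val \in H }.

HB.instance Definition _ := [isSub for subvec_val].
HB.instance Definition _ := [Choice of subvec by <:].
HB.instance Definition _ := [SubChoice_isSubLmodule of subvec by <:].

Let norm (x : subvec) := `|val x|.

Let ler_normD x y : norm (x + y) <= norm x + norm y.
Proof. exact: ler_normD. Qed.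

Let normZ a x : norm (a *: x) = `|a| * norm x.
Proof. exact: normrZ. Qed.

Let norm_eq0 x : norm x = 0 -> x = 0.
Proof. by move=> /normr0_eq0 x0; exact: val_inj. Qed.

HB.instance Definition _ := Lmodule_isNormed.Build K subvec
  ler_normD normZ norm_eq0.

End linear_subspace.

HB.instance Definition _ (I : Type) (T : I -> ptopologicalType) :=
  isPointed.Build (prod_topology T) (fun i => point).

Definition borel (T : ptopologicalType) := g_sigma_algebraType (@open T).

Definition regular_measure (R : realType) (T : ptopologicalType)
    (mu : set (borel T) -> \bar R) :=
  forall A : set (borel T), measurable A ->
    mu A = ereal_inf [set mu U | U in [set U : set T | open U /\ A `<=` U]] /\
    mu A = ereal_sup [set mu Q | Q in [set Q : set T | compact Q /\ Q `<=` A]].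

Section operators.
Context (R : realType) (s : scalar_kind).
Local Notation K := (scalars R s).

(* In \bar R, so that it is +oo, and not a junk value, on unbounded a. *)
Definition dual_norm (E : normedModType K) (a : E -> K) : \bar R :=
  ereal_sup [set (re `|a x|)%:E | x in [set x : E | `|x| <= 1]].

Definition dual_ball (E : normedModType K) : set {linear E -> K} :=
  [set a | continuous a /\ (dual_norm a <= 1)%E].

Context (m : nat) (E : 'I_m -> normedModType K) (F : normedModType K).

Definition multilinear (u : (forall i, E i) -> F) :=
  forall (z : forall i, E i) (i : 'I_m) (a : K) (x y : E i),
    u (dfwith z i (a *: x + y)) = a *: u (dfwith z i x) + u (dfwith z i y).

(* The supremum is taken in \bar R; it is finite, being at most the l^p norm of
   \prod_i `|x j i| + \prod_i `|q j i|. Completeness of E and F is not needed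
   to state the property. *)
Definition lipschitz_semi_integral (p : R) (u : (forall i, E i) -> F) :=
  exists2 C : R, 0 < C & forall (n : nat) (x q : 'I_n -> forall i, E i),
    (((\sum_(j < n) (re `|u (x j) - u (q j)|) `^ p) `^ p^-1)%:E <=
     C%:E * ereal_sup
       [set ((\sum_(j < n) (re `|\prod_i a i (x j i) - \prod_i a i (q j i)|)
               `^ p) `^ p^-1)%:E
       | a in [set a : forall i, {linear E i -> K} |
                 forall i, dual_ball (a i)]])%E.

End operators.

(* Main.v *)
(** For fixed [a i], [i != k], the expression
    [\sum_j `|\prod_i a i (x j i) - \prod_i a i (q j i)| `^ p] is the [l^p] norm,
    to the power [p], of the image under [a k] of a family in [H k]; testing [a k]
    on a suitable combination of the family bounds it by its supremum over the
    evaluations. Replacing the functionals one by one, the supremum over the dual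
    balls is at most the supremum over the points of the product space.

    The semi-integral condition then says that every finite sum of the functions
    [C `^ p * g_(T,S) - `|u T - u S| `^ p], with
    [g_(T,S) phi = `|\prod_i T i (phi i) - \prod_i S i (phi i)| `^ p], has nonnegative
    supremum, and by multilinearity these sums form a convex cone. The Hahn-Banach
    theorem on all bounded functions yields a positive normalized functional that
    is nonnegative on the cone. On indicators it is a finitely additive
    probability; its inner values on open sets generate an outer measure, hence a
    regular Borel probability that dominates it on closed sets, and the layer cake
    formula passes the domination to integrals of continuous functions. *)

Require Import Defs.
From HB Require Import structures.
From mathcomp Require Import all_boot all_order all_algebra.
From mathcomp Require Import complex.
From mathcomp Require Import all_classical all_reals all_analysis.
From mathcomp Require Import measurable_realfun.

Set Implicit Arguments.
Unset Strict Implicit.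
Unset Printing Implicit Defensive.

Import Order.TTheory GRing.Theory Num.Theory.
Import numFieldNormedType.Exports.

Local Open Scope classical_set_scope.
Local Open Scope ring_scope.

(** * Hahn-Banach theorem for sublinear functionals *)

Section hahn_banach.
Context (R : realType) (V : lmodType R).
Implicit Types (N P : V -> R) (v w : V).

Definition sublinear N :=
  (forall v w, N (v + w) <= N v + N w) /\
  (forall a v, 0 <= a -> N (a *: v) = a * N v).

Lemma sublinear0 N : sublinear N -> N 0 = 0.
Proof. by move=> [_ NZ]; rewrite -(scale0r 0) NZ// mul0r. Qed.

Lemma sublinear_geN N v : sublinear N -> - N (- v) <= N v.
Proof.
move=> Ns; have [ND _] := Ns; rewrite lerNl -subr_ge0 opprK addrC.
by rewrite -(sublinear0 Ns) -(subrr v) ND.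
Qed.

(** Superadditivity is what has to be shown: additivity then makes [N] odd, which extends positive
    homogeneity to negative scalars. *)
Lemma minimal_sublinear_linear N : sublinear N ->
  (forall N', sublinear N' -> (forall v, N' v <= N v) -> N' = N) ->
  linear (N : V -> R^o).
Proof.
move=> Ns Nmin; have [ND NZ] := Ns.
have supadd v w : N v + N w <= N (v + w).
  (* [v |-> inf_(t >= 0) (N (v + t *: w) - t * N w)] is sublinear and below [N],
     hence equal to [N]; the claim is its bound at [t = 1]. *)
  pose S v := [set N (v + t *: w) - t * N w | t in [set t | 0 <= t]].
  have S0 v' : S v' !=set0 by exists (N (v' + 0 *: w) - 0 * N w), 0 => /=.
  have Slb v' : lbound (S v') (- N (- v')).
    move=> _ [t /= t0 <-]; rewrite -NZ// lerBrDr addrC lerBlDr addrC.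
    by rewrite -{1}(addKr v' (t *: w)) ND.
  have hS v' : has_inf (S v') by split=> //; exists (- N (- v')).
  have infS v' t : 0 <= t -> inf (S v') <= N (v' + t *: w) - t * N w.
    by move=> t0; apply: ge_inf; [case: (hS v')|exists t].
  have /(congr1 (fun f => f v)) <- : (fun v => inf (S v)) = N.
    apply: Nmin; last first.
      by move=> v'; have := infS v' 0 (lexx _); rewrite scale0r mul0r addr0 subr0.
    have SD x y : inf (S (x + y)) <= inf (S x) + inf (S y).
      rewrite -lerBlDr; apply: lb_le_inf => // _ [t /= t0 <-].
      rewrite lerBlDr -lerBlDl; apply: lb_le_inf => // _ [t' /= t'0 <-].
      rewrite lerBlDl; apply: le_trans (infS _ (t + t') (addr_ge0 t0 t'0)) _.
      rewrite mulrDl opprD [leRHS]addrACA lerD2r scalerDl addrACA.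
      exact: ND.
    split=> // a x; rewrite le_eqVlt => /predU1P[<-|a0].
      rewrite scale0r mul0r; apply/eqP; rewrite eq_le; apply/andP; split.
        by have := infS 0 0 (lexx _); rewrite scale0r mul0r addr0 subr0 sublinear0.
      by apply: lb_le_inf => // y /Slb; rewrite oppr0 sublinear0// oppr0.
    have le b y : 0 < b -> inf (S (b *: y)) <= b * inf (S y).
      move=> b0; rewrite -ler_pdivrMl//; apply: lb_le_inf => // _ [t /= t0 <-].
      rewrite ler_pdivrMl//.
      apply: le_trans (infS (b *: y) _ (mulr_ge0 (ltW b0) t0)) _.
      by rewrite -scalerA -scalerDr (NZ _ _ (ltW b0)) -mulrA -mulrBr.
    apply/eqP; rewrite eq_le le//= -ler_pdivlMl//.
    by rewrite -[leLHS](_ : inf (S (a^-1 *: (a *: x))) = _) ?le ?invr_gt0//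
      scalerA mulVf ?gt_eqF// scale1r.
  by rewrite -lerBrDr; have := infS v 1 ler01; rewrite scale1r mul1r.
have addN v w : N (v + w) = N v + N w by apply/eqP; rewrite eq_le ND supadd.
have oppN v : N (- v) = - N v.
  by apply/eqP; rewrite -addr_eq0 -addN addNr sublinear0.
move=> a v w; rewrite addN; congr (_ + _).
have [a0|a0] := leP 0 a; first by rewrite NZ.
by rewrite -[a]opprK scaleNr oppN NZ ?oppr_ge0 1?ltW// scaleNr.
Qed.

(** Zorn's lemma below [P]: the pointwise infimum of a chain is finite because a sublinear [N] below
    [P] satisfies [- P (- v) <= N v]. *)
Lemma minimal_sublinear P : sublinear P ->
  exists2 N, sublinear N /\ (forall v, N v <= P v) &
    forall N', sublinear N' -> (forall v, N' v <= N v) -> N' = N.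
Proof.
move=> Ps.
pose T := {N | sublinear N /\ forall v, N v <= P v}.
(* The order is reversed, so that a maximal element is a minimal functional. *)
have := @Zorn T (fun N N' : T => `[< forall v, sval N' v <= sval N v >]).
case.
- by move=> N; apply/asboolP.
- move=> N1 N2 N3 /asboolP h1 /asboolP h2; apply/asboolP => v.
  exact: le_trans (h1 v).
- move=> [N1 h1] [N2 h2] /asboolP/= h12 /asboolP/= h21.
  have N12 : N1 = N2 by apply/funext => v; apply/eqP; rewrite eq_le h12 h21.
  by subst N2; congr exist; exact: Prop_irrelevance.
- move=> A Atot.
  have [A0|/set0P[N0 AN0]] := eqVneq A set0.
    by exists (exist _ P (conj Ps (fun v => lexx _))); rewrite A0.
  pose S v := [set sval N v | N in A].
  have S0 v : S v !=set0 by exists (sval N0 v), N0.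
  have Slb v : lbound (S v) (- P (- v)).
    move=> _ [[N [Ns NP]] /= AN <-].
    by apply: le_trans (sublinear_geN v Ns); rewrite lerN2.
  have hS v : has_inf (S v) by split=> //; exists (- P (- v)).
  have infS v (N : T) : A N -> inf (S v) <= sval N v.
    by move=> AN; apply: ge_inf; [case: (hS v)|exists N].
  have Ns : sublinear (fun v => inf (S v)).
    split.
      move=> v w; rewrite -lerBlDr; apply: lb_le_inf => // _ [N AN <-].
      rewrite lerBlDr -lerBlDl; apply: lb_le_inf => // _ [N' AN' <-].
      rewrite lerBlDl.
      (* Of two members of the chain, the smaller one serves at both [v] and [w]. *)
      wlog NN' : v w N N' AN AN' / forall v, sval N v <= sval N' v.
        move=> H; have [/asboolP NN'|/asboolP NN'] := Atot _ _ AN AN'.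
          by rewrite addrC [leRHS]addrC; exact: H.
        exact: H.
      apply: le_trans (infS _ _ AN) _.
      apply: le_trans ((svalP N).1.1 _ _) _.
      by rewrite lerD2l.
    move=> a v a0; apply/eqP; rewrite eq_le; apply/andP; split.
      rewrite le_eqVlt in a0; case/predU1P: a0 => [<-|a0].
        have := infS (0 *: v) _ AN0; rewrite mul0r => /le_trans; apply.
        by rewrite (svalP N0).1.2// mul0r.
      rewrite -ler_pdivrMl//; apply: lb_le_inf => // _ [N AN <-].
      rewrite ler_pdivrMl//; apply: le_trans (infS _ _ AN) _.
      by rewrite (svalP N).1.2// ltW.
    apply: lb_le_inf => // _ [N AN <-].
    by rewrite (svalP N).1.2// ler_wpM2l// infS.
  have NP v : inf (S v) <= P v by apply: le_trans (infS _ _ AN0) ((svalP N0).2 _).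
  exists (exist _ (fun v => inf (S v)) (conj Ns NP)) => N AN.
  by apply/asboolP => v /=; exact: infS.
move=> [N [Ns NP]] Nmin; exists N => // N' N's N'N.
have N'P v : N' v <= P v by exact: le_trans (NP v).
have := Nmin (exist _ N' (conj N's N'P)).
by move=> /(_ (introT (asboolP _) N'N)) [].
Qed.

Theorem hahn_banach P : sublinear P ->
  exists2 L : {linear V -> R^o}, True & forall v, L v <= P v.
Proof.
move=> /minimal_sublinear[N [Ns NP]] Nmin.
have Nlin := minimal_sublinear_linear Ns Nmin.
pose linN := GRing.isLinear.Build R V R^o *:%R N Nlin.
pose L : {linear V -> R^o} := HB.pack N linN.
by exists L.
Qed.

End hahn_banach.

(** * Regular Borel probability from a finitely additive one *)

Section content_measure.
Context (R : realType) (X : ptopologicalType).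
Hypotheses (cX : compact [set: X]) (hX : hausdorff_space X).
Variable lam : set X -> R.
Hypotheses (lam_ge0 : forall A, 0 <= lam A)
  (lamU : forall A B, A `&` B = set0 -> lam (A `|` B) = lam A + lam B)
  (lamT : lam setT = 1).
Implicit Types (A B U V Q : set X).
Local Open Scope ereal_scope.

Lemma additive_set0 : lam set0 = 0%R.
Proof.
by have := lamU (set0I set0); rewrite set0U => /eqP; rewrite -subr_eq subrr => /eqP.
Qed.

Lemma additive_mono A B : A `<=` B -> (lam A <= lam B)%R.
Proof.
move=> AB; rewrite -(setDUK AB) lamU; last by rewrite setDE setICA setICr setI0.
by rewrite lerDl lam_ge0.
Qed.

Lemma additive_leU A B : (lam (A `|` B) <= lam A + lam B)%R.
Proof.
rewrite -[A `|` B](setDUK (@subsetUl _ A B)) setDUD setDv set0U lamU.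
  by rewrite lerD2l additive_mono//; exact: subDsetl.
by rewrite setDE setICA setICr setI0.
Qed.

(** Only the values of [lam] on closed sets are kept; approximation from inside by closed sets, then
    from outside by open sets, yields countable subadditivity. *)
Definition inner_content U : \bar R :=
  ereal_sup [set (lam Q)%:E | Q in [set Q | closed Q /\ Q `<=` U]].

Definition outer_content A : \bar R :=
  ereal_inf [set inner_content U | U in [set U | open U /\ A `<=` U]].

Lemma le_inner_content U V : U `<=` V -> inner_content U <= inner_content V.
Proof.
move=> UV; apply: le_ereal_sup => _ [Q [cQ QU] <-].
by exists Q => //; split => //; exact: subset_trans UV.
Qed.

Lemma inner_content_ub U Q : closed Q -> Q `<=` U -> (lam Q)%:E <= inner_content U.
Proof. by move=> cQ QU; apply: ereal_sup_ubound; exists Q. Qed.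

Lemma inner_content_ge0 U : 0 <= inner_content U.
Proof.
by rewrite -[0%E]/(0%:E) -additive_set0; apply: inner_content_ub => //; exact: closed0.
Qed.

Lemma inner_content_le1 U : inner_content U <= 1.
Proof.
apply: ge_ereal_sup => _ [Q _ <-]; rewrite lee_fin -lamT.
exact: additive_mono.
Qed.

(** The parts of [Q] outside [U] and outside [V] are closed and disjoint, so normality separates
    them by open [W1] and [W2]; removing each of these from [Q] gives the two pieces. *)
Lemma closed_subsetU U V Q : open U -> open V -> closed Q -> Q `<=` U `|` V ->
  exists Q1 Q2, [/\ closed Q1, closed Q2, Q1 `<=` U, Q2 `<=` V & Q = Q1 `|` Q2].
Proof.
move=> oU oV cQ QUV.
have /(_ (Q `\` U) (Q `\` V)) := iffLR (@normal_openP R X) (compact_normal hX cX).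
case.
- by apply: closedI => //; exact: open_closedC.
- by apply: closedI => //; exact: open_closedC.
- apply/seteqP; split => // x [[Qx nUx] [_ nVx]].
  by case: (QUV _ Qx).
move=> W1 [W2] [oW1 oW2 QO1 QO2 O12].
exists (Q `\` W1), (Q `\` W2); split.
- by apply: closedI => //; exact: open_closedC.
- by apply: closedI => //; exact: open_closedC.
- by move=> x [Qx nW1x]; apply: contrapT => nUx; apply: nW1x; exact: QO1.
- by move=> x [Qx nW2x]; apply: contrapT => nUx; apply: nW2x; exact: QO2.
- by rewrite -setDIr O12 setD0.
Qed.

Lemma inner_contentU U V : open U -> open V ->
  inner_content (U `|` V) <= inner_content U + inner_content V.
Proof.
move=> oU oV; apply: ge_ereal_sup => _ [Q [cQ QUV] <-].
have [Q1 [Q2 [cQ1 cQ2 Q1U Q2V ->]]] := closed_subsetU oU oV cQ QUV.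
apply: (@le_trans _ _ ((lam Q1)%:E + (lam Q2)%:E)).
  by rewrite -EFinD lee_fin additive_leU.
by apply: leeD; exact: inner_content_ub.
Qed.

Lemma inner_content_bigsetU (U : (set X)^nat) n : (forall k, open (U k)) ->
  inner_content (\big[setU/set0]_(i < n) U i) <= \sum_(i < n) inner_content (U i).
Proof.
move=> oU; elim: n => [|n IH].
  rewrite !big_ord0; apply: ge_ereal_sup => _ [Q [_ Q0] <-].
  by rewrite lee_fin -additive_set0 additive_mono.
rewrite !big_ord_recr/=; apply: le_trans (inner_contentU _ _) _ => //.
  by rewrite -bigcup_mkord; exact: bigcup_open.
exact: leeD2r.
Qed.

(** A closed [Q] is compact, so finitely many of the open sets cover it and finite subadditivity
    applies. *)
Lemma inner_content_bigcup (U : (set X)^nat) : (forall k, open (U k)) ->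
  inner_content (\bigcup_k U k) <= \sum_(k <oo) inner_content (U k).
Proof.
move=> oU; apply: ge_ereal_sup => _ [Q [cQ QU] <-].
have : compact Q by exact: subclosed_compact cX _.
rewrite compact_cover => /(_ nat setT U) [//| |D _ QD].
  by move=> x /QU.
pose n := (\max_(i <- finmap.enum_fset D) i).+1.
have QUn : Q `<=` \big[setU/set0]_(i < n) U i.
  move=> x /QD [i /= iD Uix]; rewrite -bigcup_mkord; exists i => //=.
  by rewrite /n ltnS; exact: (@leq_bigmax_seq _ _ xpredT id).
apply: le_trans (inner_content_ub cQ QUn) _.
apply: le_trans (inner_content_bigsetU _ oU) _.
rewrite -(big_mkord xpredT (fun i => inner_content (U i))).
by apply: nneseries_lim_ge => *; exact: inner_content_ge0.
Qed.

Lemma outer_content_ge0 A : 0 <= outer_content A.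
Proof. by apply: le_ereal_inf_tmp => _ [U _ <-]; exact: inner_content_ge0. Qed.

Lemma outer_content_lb A U : open U -> A `<=` U -> outer_content A <= inner_content U.
Proof. by move=> oU AU; apply: ereal_inf_lbound; exists U. Qed.

Lemma le_outer_content A B : A `<=` B -> outer_content A <= outer_content B.
Proof.
move=> AB; apply: le_ereal_inf => _ [U [oU BU] <-].
by exists U => //; split => //; exact: subset_trans BU.
Qed.

Lemma outer_content_open U : open U -> outer_content U = inner_content U.
Proof.
move=> oU; apply/eqP; rewrite eq_le outer_content_lb//=.
apply: le_ereal_inf_tmp => _ [V [oV UV] <-]; exact: le_inner_content.
Qed.

Lemma outer_content_le1 A : outer_content A <= 1.
Proof.
by apply: le_trans (inner_content_le1 setT); apply: outer_content_lb => //; exact: openT.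
Qed.

Lemma outer_content_fin A : outer_content A \is a fin_num.
Proof.
rewrite ge0_fin_numE ?outer_content_ge0//.
exact: le_lt_trans (outer_content_le1 A) (ltry _).
Qed.

Lemma outer_content0 : outer_content set0 = 0.
Proof.
rewrite outer_content_open; last exact: open0.
apply/eqP; rewrite eq_le inner_content_ge0 andbT.
apply: ge_ereal_sup => _ [Q [_ Q0] <-].
by rewrite lee_fin -additive_set0 additive_mono.
Qed.

Lemma outer_contentT : outer_content setT = 1.
Proof.
apply/eqP; rewrite eq_le outer_content_le1/=.
rewrite outer_content_open; last exact: openT.
by rewrite -lamT; apply: inner_content_ub => //; exact: closedT.
Qed.

Lemma outer_content_closed Q : closed Q -> (lam Q)%:E <= outer_content Q.
Proof.
by move=> cQ; apply: le_ereal_inf_tmp => _ [U [oU QU] <-]; exact: inner_content_ub.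
Qed.

(** Each [A k] is enclosed in an open set with excess at most [e / 2 ^ k.+1]; the excesses add up to
    [e]. *)
Lemma outer_content_sigma_subadditive : sigma_subadditive outer_content.
Proof.
move=> A; apply/lee_addgt0Pr => e e0.
have /choice[U HU] k : exists U, [/\ open U, A k `<=` U &
    inner_content U <= outer_content (A k) + (e / (2 ^ k.+1)%:R)%:E].
  have ek : (0 < e / (2 ^ k.+1)%:R)%R by rewrite divr_gt0// ltr0n expn_gt0.
  have [_ [U [oU AU] <-] lt] := lb_ereal_inf_adherent ek (outer_content_fin (A k)).
  by exists U; split => //; exact: ltW.
apply: (@le_trans _ _ (inner_content (\bigcup_k U k))).
  apply: outer_content_lb; first by apply: bigcup_open => k _; case: (HU k).
  by apply: subset_bigcup => k _; case: (HU k).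
apply: (@le_trans _ _ (\sum_(k <oo) inner_content (U k))).
  by apply: inner_content_bigcup => k; case: (HU k).
apply: le_trans (epsilon_trick xpredT _ (ltW e0)); last first.
  by move=> k; exact: outer_content_ge0.
apply: lee_nneseries => [k _ _|k _]; first exact: inner_content_ge0.
by case: (HU k).
Qed.

HB.instance Definition _ := isOuterMeasure.Build R X outer_content
  outer_content0 outer_content_ge0 le_outer_content outer_content_sigma_subadditive.

(** The test set is enclosed in an open [V]. A closed [Q] inside [V] and [U], and a closed [Q']
    inside [V] off [Q], are disjoint with union in [V], so additivity of [lam] bounds the sum by
    [inner_content V]. *)
Lemma open_caratheodory U : open U -> outer_content.-caratheodory U.
Proof.
move=> oU; apply: le_caratheodory_measurable => A.
apply: le_ereal_inf_tmp => _ [V [oV AV] <-].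
have fAU := outer_content_fin (A `&` ~` U).
rewrite -leeBrDr//.
apply: (@le_trans _ _ (inner_content (V `&` U))).
  apply: outer_content_lb; [exact: openI|exact: setSI].
apply: ge_ereal_sup => _ [Q [cQ QVU] <-].
rewrite leeBrDr// addrC -leeBrDr//.
apply: (@le_trans _ _ (inner_content (V `\` Q))).
  apply: outer_content_lb; first by apply: openI => //; exact: closed_openC.
  by move=> x [Ax nUx]; split; [exact: AV|move=> /QVU[]].
apply: ge_ereal_sup => _ [Q' [cQ' QV] <-].
rewrite leeBrDr// -EFinD -lamU; last first.
  by apply/seteqP; split => // x [] /QV [].
apply: inner_content_ub; first exact: closedU.
by move=> x [/QV[]|/QVU[]].
Qed.

Lemma borel_caratheodory (A : set (borel X)) :
  measurable A -> outer_content.-caratheodory A.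
Proof.
suff : <<s @open X >> `<=` outer_content.-caratheodory by apply.
apply: smallest_sub; last by move=> U; exact: open_caratheodory.
split.
- exact: caratheodory_measurable_set0.
- by move=> B mB; rewrite setTD; exact: caratheodory_measurable_setC.
- by move=> F mF; exact: caratheodory_measurable_bigcup.
Qed.

(** Retyped so that the domain carries the Borel sigma-algebra. *)
Definition borel_content : set (borel X) -> \bar R := outer_content.

Lemma borel_content_sigma_additive : semi_sigma_additive borel_content.
Proof.
move=> F mF tF mbF.
have cF k : outer_content.-cara.-measurable (F k) by exact: borel_caratheodory.
have cbF : outer_content.-cara.-measurable (\bigcup_k F k).
  exact: borel_caratheodory.
exact: (@caratheodory_measure_sigma_additive R X outer_content F cF tF cbF).
Qed.

HB.instance Definition _ := isMeasure.Build _ (borel X) R borel_content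
  outer_content0 outer_content_ge0 borel_content_sigma_additive.
HB.instance Definition _ := Measure_isProbability.Build _ (borel X) R borel_content
  outer_contentT.

Lemma measurable_open U : open U -> measurable (U : set (borel X)).
Proof. by move=> oU; exact: sub_sigma_algebra. Qed.

Lemma measurable_closed Q : closed Q -> measurable (Q : set (borel X)).
Proof.
by move=> cQ; have := measurableC (measurable_open (closed_openC cQ)); rewrite setCK.
Qed.

(** Outer regularity is built in; on complements it becomes approximation by closed sets, which are
    compact. *)
Lemma borel_content_regular : regular_measure borel_content.
Proof.
move=> A mA; split.
  apply/eqP; rewrite eq_le; apply/andP; split.
    by apply: le_ereal_inf_tmp => _ [U [oU AU] <-]; exact: le_outer_content.
  apply: le_ereal_inf_tmp => _ [U [oU AU] <-].
  by apply: ereal_inf_lbound; exists U => //; exact: outer_content_open.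
apply/eqP; rewrite eq_le; apply/andP; split; last first.
  by apply: ge_ereal_sup => _ [Q [cQ QA] <-]; exact: le_outer_content.
set S := ereal_sup _.
have Sub Q : closed Q -> Q `<=` A -> outer_content Q <= S.
  move=> cQ QA; apply: ereal_sup_ubound; exists Q => //; split => //.
  exact: subclosed_compact cX _.
have S0 : 0 <= S by rewrite -outer_content0; apply: Sub => //; exact: closed0.
have S1 : S <= 1 by apply: ge_ereal_sup => _ [Q _ <-]; exact: outer_content_le1.
have Sfin : S \is a fin_num.
  by rewrite ge0_fin_numE// (le_lt_trans S1)// ltry.
have setC B : measurable (B : set (borel X)) ->
    outer_content (~` B) = 1 - outer_content B.
  by move=> mB; exact: (probability_setC borel_content mB).
rewrite -[X in borel_content X]setCK [leLHS]setC; last exact: measurableC.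
rewrite leeBlDr ?outer_content_fin// addeC -leeBlDr//.
apply: le_ereal_inf_tmp => _ [U [oU AU] <-].
rewrite leeBlDr// addeC -leeBlDr -?outer_content_open// ?outer_content_fin//.
rewrite -setC; last exact: measurable_open.
by apply: Sub; [exact: open_closedC|rewrite -(setCK A); exact: subsetC].
Qed.

(** Mass that [lam] gives to every open neighbourhood of [Q] counts in [nu Q], even if [lam Q] is
    smaller; hence an inequality. *)
Theorem additive_borel_probability :
  exists2 nu : probability (borel X) R, regular_measure nu &
    forall Q, closed Q -> (lam Q)%:E <= nu Q.
Proof.
exists borel_content; first exact: borel_content_regular.
exact: outer_content_closed.
Qed.

End content_measure.

(** * The space of bounded real functions *)

Section bounded_functions.
Context (R : realType) (X : Type).

(** Continuity is not imposed, so that indicators belong to the space and a functional on it induces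
    a set function. *)
Definition bounded_pred : {pred (X -> R)} :=
  mem [set f : X -> R | exists M, forall x, `|f x| <= M].

Lemma bounded_pred_submod : submod_closed bounded_pred.
Proof.
split; first by rewrite inE /=; exists 0 => x; rewrite normr0.
move=> a f g; rewrite !inE /= => -[M fM] [N gN]; exists (`|a| * M + N) => x.
by rewrite (le_trans (ler_normD _ _))// lerD// normrM ler_wpM2l.
Qed.

HB.instance Definition _ :=
  GRing.isSubmodClosed.Build _ _ bounded_pred bounded_pred_submod.

Record bfun := Bfun { bfun_fun :> X -> R ; bfunP : bfun_fun \in bounded_pred }.

HB.instance Definition _ := [isSub for bfun_fun].
HB.instance Definition _ := [Choice of bfun by <:].
HB.instance Definition _ := [SubChoice_isSubLmodule of bfun by <:].

Lemma bfunE (f : bfun) : exists M, forall x, `|f x| <= M.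
Proof. by case: f => f; rewrite /= inE. Qed.

Definition mk_bfun (f : X -> R) (bf : exists M, forall x, `|f x| <= M) : bfun :=
  Bfun (mem_set bf : f \in bounded_pred).

Lemma bfun_sumE (I : Type) (r : seq I) (F : I -> bfun) x :
  (\sum_(i <- r) F i) x = \sum_(i <- r) F i x.
Proof. by apply: (big_morph (fun f : bfun => f x)). Qed.

Lemma indic_bounded (A : set X) : exists M, forall x, `|\1_A x : R| <= M.
Proof. by exists 1 => x; rewrite indicE ger0_norm// lern1 leq_b1. Qed.

Definition bindic (A : set X) : bfun := mk_bfun (indic_bounded A).

End bounded_functions.

(** * Positive normalized functionals nonnegative on a cone *)

Section mean.
Context (R : realType) (X : pointedType).
Implicit Types (f g d : bfun R X).

Theorem exists_mean (D : set (bfun R X)) :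
  D 0 -> (forall d d', D d -> D d' -> D (d + d')) ->
  (forall a d, 0 <= a -> D d -> D (a *: d)) ->
  (forall d e, D d -> 0 < e -> exists x, - e <= d x) ->
  exists L : {linear bfun R X -> R^o},
    [/\ forall f, (forall x, 0 <= f x) -> 0 <= L f,
        L (bindic R setT) = 1 & forall d, D d -> 0 <= L d].
Proof.
move=> D0 DD DZ Dge.
(* [P f] is the infimum of the upper bounds of the functions [f + d] with [d] in
   [D]; in particular [P (- d) <= 0], so that [L <= P] forces [0 <= L d]. *)
pose S f := [set t | exists2 d, D d & forall x, f x + d x <= t].
(* The hypothesis [Dge] enters here: where [d] is at least [- e], [f + d] is at least [- M - e].
   This keeps the infimum [P] finite. *)
have Slb f M : (forall x, - M <= f x) -> lbound (S f) (- M).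
  move=> fM t [d Dd dt]; apply/ler_addgt0Pr => e e0.
  have [x dx] := Dge d e Dd e0.
  by rewrite -lerBlDr; apply: le_trans (dt x); apply: lerD.
have hS f : has_inf (S f).
  have [M fM] := bfunE f; split.
    exists M, 0 => // x; rewrite addr0.
    exact: le_trans (ler_norm _) (fM x).
  exists (- M); apply: Slb => x.
  by rewrite lerNl (le_trans _ (fM x))// -normrN ler_norm.
pose P f := inf (S f).
have Ple f t d : D d -> (forall x, f x + d x <= t) -> P f <= t.
  by move=> Dd ft; apply: ge_inf; [case: (hS f)|exists d].
have Ps : sublinear P.
  split.
    move=> f g; rewrite -lerBlDr; apply: lb_le_inf; first by case: (hS f).
    move=> t [d Dd ft]; rewrite lerBlDr -lerBlDl.
    apply: lb_le_inf; first by case: (hS g).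
    move=> t' [d' Dd' ft']; rewrite lerBlDl; apply: (Ple _ _ (d + d')); first exact: DD.
    by move=> x; rewrite /= addrACA lerD.
  have PZ a f : 0 <= a -> P (a *: f) <= a * P f.
    rewrite le_eqVlt => /predU1P[<-|a0].
      rewrite scale0r mul0r; apply: (Ple _ _ 0) => // x.
      by rewrite /= addr0.
    rewrite -ler_pdivrMl//; apply: lb_le_inf; first by case: (hS f).
    move=> t [d Dd ft]; rewrite ler_pdivrMl//; apply: (Ple _ _ (a *: d)).
      exact: DZ (ltW a0) Dd.
    by move=> x; rewrite /= -mulrDr ler_wpM2l// ltW.
  move=> a f; rewrite le_eqVlt => /predU1P[<-|a0].
    rewrite scale0r mul0r; apply/eqP; rewrite eq_le; apply/andP; split.
      by apply: (Ple _ _ 0) => // x; rewrite /= addr0.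
    apply: lb_le_inf; first by case: (hS 0).
    by have := @Slb 0 0; rewrite oppr0; exact.
  apply/eqP; rewrite eq_le (PZ _ _ (ltW a0))/= -ler_pdivlMl//.
  have ai0 : 0 <= a^-1 by rewrite invr_ge0 ltW.
  by have := PZ _ (a *: f) ai0; rewrite scalerA mulVf ?gt_eqF// scale1r.
have [L _ LP] := hahn_banach Ps.
(* An upper bound for [P (- f)] read as a lower bound for [L f]. Positivity uses [t = 0] and
   [d = 0], the lower half of normalization [t = -1] and [d = 0], nonnegativity on [D] uses [t = 0]
   and [f = d]. *)
have LN f t d : D d -> (forall x, d x <= f x + t) -> - t <= L f.
  move=> Dd df; rewrite lerNl -linearN; apply: le_trans (LP _) _.
  by apply: (Ple _ _ d) => // x; rewrite /= addrC lerBlDl.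
exists L; split.
- by move=> f f0; have := @LN f 0 0; rewrite oppr0; apply => // x; rewrite addr0.
- apply/eqP; rewrite eq_le; apply/andP; split.
    apply: le_trans (LP _) _; apply: (Ple _ _ 0) => // x.
    by rewrite /= addr0 indicE in_setT.
  rewrite -[leLHS]opprK; apply: (LN _ _ 0) => // x.
  by rewrite /= indicE in_setT subrr.
- by move=> d Dd; have := @LN d 0 d; rewrite oppr0; apply => // x; rewrite addr0.
Qed.

End mean.

(** * Step functions of the layer cake formula *)

Section layer_cake.
Context (R : realType).
Implicit Types (g e : R) (N : nat).

(** For [0 <= g] and [0 < e] this is [e * min(N, floor(g / e))], split over superlevel conditions so
    that functionals apply term by term. *)
Definition layers N e g : R := \sum_(k < N) e * (k.+1%:R * e <= g)%R%:R.

Lemma layersS N e g :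
  layers N.+1 e g = layers N e g + e * (N.+1%:R * e <= g)%R%:R.
Proof. by rewrite /layers big_ord_recr. Qed.

Lemma layers_full N e g : 0 < e -> N%:R * e <= g -> layers N e g = N%:R * e.
Proof.
move=> e0; elim: N => [|N IH] Ng; first by rewrite /layers big_ord0 mul0r.
rewrite layersS Ng mulr1 IH; first by rewrite -[N.+1]addn1 natrD mulrDl mul1r.
by apply: le_trans Ng; rewrite ler_wpM2r ?ler_nat// ltW.
Qed.

Lemma layers_le N e g : 0 < e -> 0 <= g -> layers N e g <= g.
Proof.
move=> e0 g0; elim: N => [|N IH]; first by rewrite /layers big_ord0.
have [Ng|Ng] := leP (N.+1%:R * e) g; first by rewrite layers_full.
by rewrite layersS (lt_geF Ng) mulr0 addr0.
Qed.

Lemma le_layers N e g : 0 < e -> g <= N.+1%:R * e -> g <= e + layers N e g.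
Proof.
move=> e0; elim: N => [|N IH] gN; first by rewrite /layers big_ord0 addr0 -[e]mul1r.
have [Ng|Ng] := leP (N.+1%:R * e) g.
  by move: gN; rewrite layers_full// -(natr1 N.+1) mulrDl mul1r addrC.
by rewrite layersS (lt_geF Ng) mulr0 addr0 IH// ltW.
Qed.

End layer_cake.

(** * Comparison of means with integrals *)

Section mean_integral.
Context (R : realType) (X : ptopologicalType).
Local Open Scope ereal_scope.

Lemma continuous_borel_measurable (g : X -> R) :
  continuous g -> measurable_fun [set: borel X] (g : borel X -> R).
Proof.
move=> cg; apply: (measurability _ (RGenOInfty.measurableE R)).
move=> _ [_ [a ->] <-]; rewrite setTI; apply: measurable_open.
by apply: open_comp => [x _|]; [exact: cg|exact: interval_open].
Qed.

Lemma closed_superlevel (g : X -> R) a : continuous g ->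
  closed [set x | (a <= g x)%R].
Proof.
move=> cg; have := @closed_comp _ _ g [set y | (a <= y)%R]; apply.
  by move=> x _; exact: cg.
exact: closed_ge.
Qed.

(** The left side is the integral of [layers N e (g x)], a step function below [g]. *)
Lemma layers_le_integral (nu : probability (borel X) R) (g : X -> R) N e :
  continuous g -> (forall x, 0 <= g x)%R -> (0 < e)%R ->
  \sum_(k < N) e%:E * nu [set x | (k.+1%:R * e <= g x)%R] <=
  \int[nu]_x (g x)%:E.
Proof.
move=> cg g0 e0.
have mQ (k : nat) : measurable ([set x | (k.+1%:R * e <= g x)%R] : set (borel X)).
  by apply: measurable_closed; exact: closed_superlevel.
have indQ (k : nat) : (fun x : borel X => (k.+1%:R * e <= g x)%R%:R : R) =
    \1_[set x | (k.+1%:R * e <= g x)%R].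
  by apply/funext => x; rewrite indicE mem_setE.
have mf (k : nat) : measurable_fun setT
    (fun x : borel X => (e * (k.+1%:R * e <= g x)%R%:R)%:E).
  by apply/measurable_EFinP/measurable_funM => //; rewrite indQ; exact: measurable_indic.
have f0 (k : nat) x : 0 <= (e * (k.+1%:R * e <= g x)%R%:R)%:E.
  by rewrite lee_fin mulr_ge0// ltW.
have -> : \sum_(k < N) e%:E * nu [set x | (k.+1%:R * e <= g x)%R] =
    \int[nu]_x (layers N e (g x))%:E.
  under eq_integral do rewrite /layers -sumEFin.
  rewrite ge0_integral_sum//; apply: eq_bigr => k _.
  under eq_integral do rewrite EFinM.
  rewrite ge0_integralZl ?lee_fin ?ltW//; last first.
    by apply/measurable_EFinP; rewrite indQ; exact: measurable_indic.
  congr (_ * _); have /(congr1 (fun h => \int[nu]_x (h x)%:E)) -> := indQ k.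
  by rewrite integral_indic// setIT.
apply: ge0_le_integral => //.
- by move=> x _; rewrite /layers -sumEFin; apply: sume_ge0.
- by under eq_fun do rewrite /layers -sumEFin; exact: emeasurable_sum.
- by apply/measurable_EFinP; exact: continuous_borel_measurable.
- by move=> x _; rewrite lee_fin layers_le.
Qed.

(* Layer cake: [g] and the step functions below it differ by at most [e], and
   [L \1_Q <= nu Q] on the closed superlevel sets [Q] of [g]. *)
Lemma mean_le_integral (nu : probability (borel X) R) (L : {linear bfun R X -> R^o})
    (g : bfun R X) :
  (forall f : bfun R X, (forall x, 0 <= f x)%R -> (0 <= L f)%R) ->
  L (bindic R setT) = 1%R ->
  (forall Q, closed Q -> (L (bindic R Q))%:E <= nu Q) ->
  continuous g -> (forall x, 0 <= g x)%R ->
  (L g)%:E <= \int[nu]_x (g x)%:E.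
Proof.
move=> L0 L1 LQ cg g0; apply/lee_addgt0Pr => e e0.
have [M gM] := bfunE g.
(* With this choice [M <= N%:R * e], so [N] layers come within [e] of [g] everywhere. *)
pose N := Num.bound (M / e).
have M0 : (0 <= M)%R by apply: le_trans (gM point).
have gN x : (g x <= N.+1%:R * e)%R.
  rewrite -ler_pdivrMr//; apply: (@le_trans _ _ (M / e)%R).
    by rewrite ler_pM2r ?invr_gt0// (le_trans (ler_norm _) (gM x)).
  apply: (@le_trans _ _ N%:R); last by rewrite ler_nat.
  by apply/ltW/archi_boundP; rewrite divr_ge0// ltW.
pose Q (k : nat) := [set x | (k.+1%:R * e <= g x)%R].
have Lg : (L g <= e + \sum_(k < N) e * L (bindic R (Q k)))%R.
  rewrite -subr_ge0.
  suff : (0 <= L (e *: bindic R setT + \sum_(k < N) e *: bindic R (Q k) - g))%R.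
    rewrite linearB linearD linearZ linear_sum/= L1 [(e *: _)%R]mulr1.
    by under eq_bigr do rewrite linearZ.
  apply: L0 => x.
  change (0 <= e * \1_[set: X] x + (\sum_(k < N) e *: bindic R (Q k)) x - g x)%R.
  rewrite indicE in_setT mulr1 bfun_sumE subr_ge0.
  apply: le_trans (le_layers e0 (gN x)) _; rewrite lerD2l le_eqVlt.
  apply/orP; left; apply/eqP/eq_bigr => k _.
  by transitivity (e * \1_(Q k) x)%R => //; rewrite indicE mem_setE.
rewrite addeC.
apply: (@le_trans _ _ (e%:E + \sum_(k < N) e%:E * (L (bindic R (Q k)))%:E)).
  by under eq_bigr do rewrite -EFinM; rewrite sumEFin -EFinD lee_fin.
apply: leeD2l; apply: le_trans (layers_le_integral nu N cg g0 e0).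
apply: lee_sum => k _; apply: lee_wpmul2l; first by rewrite lee_fin ltW.
by apply: LQ; exact: closed_superlevel.
Qed.

(** A mean [L] for [D] gives a finitely additive probability on indicators, hence [nu]. If [g - c]
    lies in [D], then [c <= L g], and [L g] is at most the integral of [g]. *)
Theorem exists_dominating_measure (D : set (bfun R X)) :
  compact [set: X] -> hausdorff_space X ->
  D 0%R -> (forall d d', D d -> D d' -> D (d + d')%R) ->
  (forall a d, (0 <= a)%R -> D d -> D (a *: d)%R) ->
  (forall d e, D d -> (0 < e)%R -> exists x, (- e <= d x)%R) ->
  exists2 nu : probability (borel X) R, regular_measure nu &
    forall (g : bfun R X) (c : R), continuous g -> (forall x, 0 <= g x)%R ->
      D (g - c *: bindic R setT)%R -> c%:E <= \int[nu]_x (g x)%:E.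
Proof.
move=> cX hX D0 DD DZ Dge.
have [L [L0 L1 LD]] := exists_mean D0 DD DZ Dge.
have indic0 (A : set X) x : (0 <= bindic R A x)%R by rewrite /= indicE.
have LU A B : A `&` B = set0 ->
    L (bindic R (A `|` B)) = (L (bindic R A) + L (bindic R B))%R.
  move=> AB; rewrite -linearD; congr (L _); apply/val_inj/funext => x /=.
  transitivity (\1_A x + \1_B x : R)%R => //; rewrite !indicE in_setU.
  have [Ax|] := boolP (x \in A); last by rewrite add0r.
  suff -> : (x \in B) = false by rewrite addr0.
  apply/negbTE/negP => Bx; move: AB => /seteqP[/(_ x) + _]; apply.
  by split; exact: set_mem.
have [nu nureg LQ] := additive_borel_probability cX hX
  (fun A => L0 _ (indic0 A)) LU L1.
exists nu => // g c cg g0 /LD.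
rewrite linearB linearZ/= L1 [(c *: _)%R]mulr1 subr_ge0 => cLg.
by apply: le_trans (mean_le_integral L0 L1 LQ cg g0); rewrite lee_fin.
Qed.

End mean_integral.

(** * Moduli of scalars and Young's inequality *)

Section scalars_extra.
Context (R : realType) (s : scalar_kind).
Implicit Types (a : R) (x : scalars R s).

Lemma of_real1 : of_real s 1 = 1 :> scalars R s.
Proof. by case: s. Qed.

Lemma re_norm_of_real a : 0 <= a -> re `|of_real s a| = a.
Proof. by move=> a0; rewrite ger0_norm ?of_realK// -of_real0 ler_of_real. Qed.

Lemma re_normV x : re `|x^-1| = (re `|x|)^-1.
Proof.
have [->|x0] := eqVneq x 0; first by rewrite invr0 normr0 -of_real0 of_realK invr0.
apply: (mulfI (x := re `|x|)).
  by apply: contra_neq x0 => /re_norm_eq0.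
rewrite -re_normM mulfV// normr1 -of_real1 of_realK mulfV//.
by apply: contra_neq x0 => /re_norm_eq0.
Qed.

Lemma re_norm_sum n (F : 'I_n -> scalars R s) :
  re `|\sum_j F j| <= \sum_j re `|F j|.
Proof.
elim/big_rec2: _ => [|j a x _ xa]; first by rewrite normr0 -of_real0 of_realK.
by apply: le_trans (re_normD _ _) _; rewrite lerD2l.
Qed.

Lemma of_real_sum n (F : 'I_n -> R) :
  of_real s (\sum_j F j) = \sum_j of_real s (F j).
Proof. by apply: (big_morph (of_real s)); [exact: of_realD|exact: of_real0]. Qed.

Lemma re_normZ (V : normedModType (scalars R s)) (c : scalars R s) (v : V) :
  re `|c *: v| = re `|c| * re `|v|.
Proof. by rewrite -[RHS](of_realK s) of_realM !reK// -normrZ. Qed.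

End scalars_extra.

(** For [0 < t] and [1 < p] this is Young's inequality for [y] and the power [p - 1] of [t], with
    exponents [p] and [p / (p - 1)]. The quotient form matches the coefficients of the duality
    argument and is [0] at [t = 0]; [p = 1] is separate, its conjugate exponent being infinite. *)
Lemma young_powR (R : realType) (t y p : R) : 0 <= t -> 0 <= y -> 1 <= p ->
  t `^ p / t * y <= (1 - p^-1) * t `^ p + p^-1 * y `^ p.
Proof.
move=> t0 y0; rewrite le_eqVlt => /predU1P[<-|p1].
  rewrite !powRr1// invr1 subrr mul0r add0r mul1r.
  have [->|tn0] := eqVneq t 0; first by rewrite !mul0r.
  by rewrite divff// mul1r.
have p0 : 0 < p by exact: lt_trans p1.
have pV1 : p^-1 < 1 by rewrite invf_lt1.
move: t0; rewrite le_eqVlt => /predU1P[<-|t0].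
  by rewrite invr0 mulr0 mul0r addr_ge0// mulr_ge0 ?powR_ge0 ?subr_ge0 ?invr_ge0// ltW.
have -> : t `^ p / t = t `^ (p - 1).
  by rewrite powRB ?powRr1 ?(ltW t0)// gt_eqF// implybT.
have p10 : 0 < p - 1 by rewrite subr_gt0.
pose q := p / (p - 1).
have q0 : 0 < q by rewrite divr_gt0.
have qV : q^-1 = 1 - p^-1 by rewrite /q invf_div mulrBl mul1r divff// gt_eqF.
have := @conjugate_powR _ (t `^ (p - 1)) y q p (powR_ge0 _ _) y0 q0 p0.
rewrite qV subrK => /(_ erefl); rewrite -powRrM /q mulrCA divff ?gt_eqF// mulr1.
by rewrite [_ * (1 - _)]mulrC [_ / p]mulrC.
Qed.

(** * Functionals in the dual ball against evaluations *)

Section dual_ball_evaluations.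
Context (R : realType) (s : scalar_kind) (K : compactHausdorffType).
Context (H : submodClosed (cfun R s K)).
Implicit Types (f : subvec H) (x : K).

Lemma subvec_normE f :
  `|f| = of_real s (sup [set re `|subvec_val f x| | x in [set: K]]).
Proof. exact: erefl. Qed.

Lemma subvecDE f g x : subvec_val (f + g) x = subvec_val f x + subvec_val g x.
Proof.
have -> : subvec_val (f + g) = subvec_val f + subvec_val g by exact: erefl.
exact: erefl.
Qed.

Lemma subvecNE f x : subvec_val (- f) x = - subvec_val f x.
Proof.
have -> : subvec_val (- f) = - subvec_val f by exact: erefl.
exact: erefl.
Qed.

Lemma subvecZE c f x : subvec_val (c *: f) x = c * subvec_val f x.
Proof.
have -> : subvec_val (c *: f) = c *: subvec_val f by exact: erefl.
exact: erefl.
Qed.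

Lemma subvec_sumE n (f : 'I_n -> subvec H) x :
  subvec_val (\sum_j f j) x = \sum_j subvec_val (f j) x.
Proof.
apply: (big_morph (fun f : subvec H => subvec_val f x)); last exact: erefl.
by move=> g h; exact: subvecDE.
Qed.

Lemma subvec_norm_le f x : `|subvec_val f x| <= `|f|.
Proof. by rewrite subvec_normE -[leLHS]reK// ler_of_real; exact: sup_norm_ub. Qed.

Definition evaluation x f : scalars R s := subvec_val f x.

Lemma evaluation_linear x : linear (evaluation x).
Proof. by move=> a f g; rewrite /evaluation subvecDE subvecZE. Qed.

HB.instance Definition _ x :=
  GRing.isLinear.Build _ _ _ *:%R (evaluation x) (evaluation_linear x).

Lemma dual_ball_evaluation x : dual_ball (evaluation x).
Proof.
split.
  move=> f; have FF := @nbhs_filter (subvec H) f.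
  apply/(@cvgrPdist_lt _ _ _ _ FF) => e e0.
  have fe : \forall g \near f, `|f - g| < e by apply/nbhs_ballP; exists e.
  apply: filterS fe => g; apply: le_lt_trans; exact: (subvec_norm_le (f - g)).
apply: ge_ereal_sup => _ [f /= f1 <-]; rewrite lee_fin.
rewrite -(ler_of_real s) of_real1 reK//; apply: le_trans f1.
exact: subvec_norm_le.
Qed.

(** The functional is tested on [f / (B + e)], which lies in the unit ball; the added [e] avoids
    division by [B = 0]. *)
Lemma dual_ball_le (a : {linear subvec H -> scalars R s}) f (B : R) :
  dual_ball a -> 0 <= B -> (forall x, re `|subvec_val f x| <= B) ->
  re `|a f| <= B.
Proof.
move=> [_ a1] B0 fB; apply/ler_addgt0Pr => e e0.
have Be0 : 0 < B + e by rewrite ltr_wpDl.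
have Bei0 : 0 <= (B + e)^-1 by rewrite invr_ge0 ltW.
pose g := of_real s (B + e)^-1 *: f.
have g1 : `|g| <= 1.
  rewrite subvec_normE -(of_real1 R s) ler_of_real; apply: ge_sup.
    by case: (has_sup_cfun (subvec_val g)).
  move=> _ [x _ <-]; rewrite subvecZE re_normM re_norm_of_real// ler_pdivrMl// mulr1.
  by apply: le_trans (fB x) _; rewrite lerDl ltW.
have : ((re `|a g|)%:E <= 1)%E.
  by apply: le_trans a1; apply: ereal_sup_ubound; exists g.
by rewrite lee_fin linearZ/= re_normM re_norm_of_real// ler_pdivrMl// mulr1.
Qed.

(* Testing [a] on [\sum_j c j *: f j], where [c j * a (f j) = `|a (f j)| `^ p],
   gives the [l^p] bound by duality. *)
Lemma dual_ball_sum_powR_le (p M : R) (a : {linear subvec H -> scalars R s})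
    n (f : 'I_n -> subvec H) :
  1 <= p -> dual_ball a ->
  (forall x, \sum_j re `|subvec_val (f j) x| `^ p <= M) ->
  \sum_j re `|a (f j)| `^ p <= M.
Proof.
move=> p1 a1 fM.
have p0 : 0 < p by exact: lt_le_trans p1.
have M0 : 0 <= M by apply: le_trans (fM point); apply: sumr_ge0 => j _; exact: powR_ge0.
pose t j := re `|a (f j)|.
have t0 j : 0 <= t j by exact: re_norm_ge0.
pose S := \sum_j t j `^ p.
have S0 : 0 <= S by apply: sumr_ge0 => j _; exact: powR_ge0.
(* If [a (f j) = 0] the quotient is [0] by convention, and [cE] still holds since then [t j = 0] and
   [0 < p]. *)
pose c j := of_real s (t j `^ p) / a (f j).
have cE j : c j * a (f j) = of_real s (t j `^ p).
  have [af0|af0] := eqVneq (a (f j)) 0; last by rewrite /c divfK.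
  rewrite af0 mulr0 /t af0 normr0 -[in RHS](of_real0 R s) of_realK powR0 ?gt_eqF//.
  by rewrite of_real0.
have nc j : re `|c j| = t j `^ p / t j.
  by rewrite /c re_normM re_norm_of_real ?powR_ge0// re_normV.
(* Young's inequality, summed over [j], bounds the test function by [B]; in [S <= B] the multiples
   of [S] cancel down to [p^-1 * S <= p^-1 * M]. *)
pose B := (1 - p^-1) * S + p^-1 * M.
have pV1 : 0 <= 1 - p^-1 by rewrite subr_ge0 invf_le1.
have B0 : 0 <= B by rewrite addr_ge0// mulr_ge0// invr_ge0 ltW.
have SB : S <= B.
  have -> : S = re `|a (\sum_j c j *: f j)|.
    rewrite linear_sum (eq_bigr (fun j => of_real s (t j `^ p))); last first.
      by move=> j _; rewrite -cE linearZ.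
    by rewrite -of_real_sum re_norm_of_real.
  apply: dual_ball_le => // x.
  have -> : subvec_val (\sum_j c j *: f j) x = \sum_j c j * subvec_val (f j) x.
    by rewrite subvec_sumE; apply: eq_bigr => j _; rewrite subvecZE.
  apply: le_trans (re_norm_sum _) _.
  apply: (@le_trans _ _ (\sum_j ((1 - p^-1) * t j `^ p +
      p^-1 * re `|subvec_val (f j) x| `^ p))).
    apply: ler_sum => j _; rewrite re_normM nc.
    by apply: young_powR => //; exact: re_norm_ge0.
  rewrite big_split/= -!mulr_sumr lerD2l ler_wpM2l// invr_ge0 ltW//.
have : p^-1 * S <= p^-1 * M.
  by move: SB; rewrite /B mulrBl mul1r -lerBlDl opprB addrC subrK.
by rewrite ler_pM2l// invr_gt0.
Qed.

End dual_ball_evaluations.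

(** * Replacement of functionals by point evaluations *)

Section products.
Context (R : realType) (s : scalar_kind) (m : nat) (K : 'I_m -> compactHausdorffType).
Context (H : forall i, submodClosed (cfun R s (K i))).

(* The expression is the [l^p] norm of a linear function of each functional [a i]
   separately, so the [a i] can be replaced by evaluations one index at a time. *)
Lemma dual_ball_sum_prod_le (p M : R) n (x q : 'I_n -> forall i, subvec (H i))
    (a : forall i, {linear subvec (H i) -> scalars R s}) :
  1 <= p -> (forall i, dual_ball (a i)) ->
  (forall phi : forall i, K i,
    \sum_j re `|\prod_i subvec_val (x j i) (phi i) -
                \prod_i subvec_val (q j i) (phi i)| `^ p <= M) ->
  \sum_j re `|\prod_i a i (x j i) - \prod_i a i (q j i)| `^ p <= M.
Proof.
move=> p1 a1 xqM.
(* Functionals at the indices below [k], evaluations at the others: [b 0] is the hypothesis, [b m]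
   the claim. *)
pose b k (phi : forall i, K i) (z : forall i, subvec (H i)) (i : 'I_m) :=
  if (i < k)%N then a i (z i) else subvec_val (z i) (phi i).
suff bM k phi : \sum_j re `|\prod_i b k phi (x j) i - \prod_i b k phi (q j) i| `^ p <= M.
  have prodb z : \prod_i b m (fun=> point) z i = \prod_i a i (z i).
    by apply: eq_bigr => i _; rewrite /b ltn_ord.
  by have := bM m (fun=> point); under eq_bigr do rewrite !prodb.
(* [phi] stays general because the step uses the induction hypothesis at all points differing from
   [phi] in coordinate [k]. *)
elim: k phi => [|k IH] phi; first exact: xqM.
have [km|mk] := ltnP k m; last first.
  have bS z i : b k.+1 phi z i = b k phi z i.
    by rewrite /b (leq_trans (ltn_ord i) mk) ltnS (leq_trans (ltnW (ltn_ord i)) mk).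
  have prodbS z : \prod_i b k.+1 phi z i = \prod_i b k phi z i by exact: eq_bigr.
  by under eq_bigr do rewrite !prodbS.
pose i0 := Ordinal km.
(* These factors agree for [b k] and [b k.+1] and ignore coordinate [i0] of the point, so they act
   as fixed scalars. *)
pose rest z := \prod_(i | i != i0) b k phi z i.
pose f j := rest (x j) *: x j i0 - rest (q j) *: q j i0.
have bS z : \prod_i b k.+1 phi z i = rest z * a i0 (z i0).
  rewrite (bigD1 i0)//= mulrC /b/= ltnSn; congr (_ * _).
  apply: eq_bigr => i ii0; rewrite ltnS leq_eqVlt.
  by rewrite (_ : (i == k :> nat) = false)//; apply/negbTE.
have bk z psi : \prod_i b k (dfwith phi i0 psi) z i = rest z * subvec_val (z i0) psi.
  rewrite (bigD1 i0)//= mulrC /b/= ltnn dfwithin; congr (_ * _).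
  by apply: eq_bigr => i ii0; rewrite dfwithout// eq_sym.
have -> : \sum_j re `|\prod_i b k.+1 phi (x j) i - \prod_i b k.+1 phi (q j) i| `^ p =
    \sum_j re `|a i0 (f j)| `^ p.
  by apply: eq_bigr => j _; rewrite !bS /f linearB !linearZ.
apply: dual_ball_sum_powR_le => // psi.
have fE j : subvec_val (f j) psi =
    rest (x j) * subvec_val (x j i0) psi - rest (q j) * subvec_val (q j i0) psi.
  by rewrite /f subvecDE subvecNE !subvecZE.
have := IH (dfwith phi i0 psi); congr (_ <= M).
by apply: eq_bigr => j _; rewrite !bk fE.
Qed.

End products.

(** Differentiability of the power settles [y != 0]; at [0] the radius is [e] to the power
    [p^-1]. *)
Lemma continuous_norm_powR (R : realType) (p : R) : 0 < p ->
  continuous (fun y : R => `|y| `^ p).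
Proof.
move=> p0 y; have [->|y0] := eqVneq y 0; last first.
  have ny0 : 0 < `|y| by rewrite normr_gt0.
  have ny : `|y| \in `]0, +oo[ by rewrite in_itv/= ny0.
  have cp : {for `|y|, continuous (fun z : R => z `^ p)}.
    apply: differentiable_continuous; apply/derivable1_diffP.
    exact: derivable_powR.
  exact: (continuous_comp (@norm_continuous _ _ y) cp).
rewrite /continuous_at normr0 powR0 ?gt_eqF//.
apply/cvgrPdist_lt => e e0; apply/nbhs_ballP; exists (e `^ p^-1) => /=.
  exact: powR_gt0.
move=> z; rewrite /ball/= !sub0r !normrN => ze.
rewrite ger0_norm ?powR_ge0//.
have -> : e = (e `^ p^-1) `^ p by rewrite -powRrM mulVf ?gt_eqF// powRr1// ltW.
by rewrite gt0_ltr_powR// nnegrE ?powR_ge0.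
Qed.

(** * Compactness of the product and continuity of the integrand *)

Section products_topology.
Context (R : realType) (s : scalar_kind) (m : nat) (K : 'I_m -> compactHausdorffType).
Context (H : forall i, submodClosed (cfun R s (K i))).
Implicit Types T S : forall i, subvec (H i).

Lemma compact_prod_topology : compact [set: prod_topology K].
Proof.
have := @tychonoff _ _ (fun i => [set: K i]) (fun i => @compact_space (K i)).
by congr compact; apply/seteqP; split.
Qed.

Lemma hausdorff_prod_topology : hausdorff_space (prod_topology K).
Proof. by apply: hausdorff_product => i; exact: hausdorff_compact. Qed.

Lemma continuous_prod_eval T :
  continuous (fun phi : prod_topology K => \prod_i subvec_val (T i) (phi i)).
Proof.
suff cr (r : seq 'I_m) :
    continuous (fun phi : prod_topology K => \prod_(i <- r) subvec_val (T i) (phi i)).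
  exact: cr.
elim: r => [|i r IH] phi.
  rewrite (_ : (fun _ => _) = cst 1); last by apply/funext => ?; rewrite big_nil.
  exact: cst_continuous.
rewrite (_ : (fun _ => _) = (fun phi : prod_topology K =>
    subvec_val (T i) (phi i) * \prod_(i <- r) subvec_val (T i) (phi i))); last first.
  by apply/funext => ?; rewrite big_cons.
apply: (@continuousM (scalars R s) (prod_topology K)); last exact: IH.
apply: continuous_comp; first exact: proj_continuous.
by have := cfun_continuous (subvec_val (T i)); rewrite inE; apply.
Qed.

Definition prod_dist_powR (p : R) T S (phi : prod_topology K) : R :=
  re `|\prod_i subvec_val (T i) (phi i) - \prod_i subvec_val (S i) (phi i)| `^ p.

Lemma prod_dist_powR_ge0 p T S phi : 0 <= prod_dist_powR p T S phi.
Proof. exact: powR_ge0. Qed.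

Lemma continuous_prod_dist_powR p T S : 0 < p -> continuous (prod_dist_powR p T S).
Proof.
move=> p0 phi.
rewrite /prod_dist_powR (_ : (fun _ => _) = (fun y => `|y| `^ p) \o
    (fun phi : prod_topology K => re `|\prod_i subvec_val (T i) (phi i) -
      \prod_i subvec_val (S i) (phi i)|)); last first.
  by apply/funext => psi; rewrite /= (ger0_norm (re_norm_ge0 _)).
apply: continuous_comp; last exact: continuous_norm_powR.
apply: (continuous_comp (g := fun x : scalars R s => re `|x|)); last first.
  exact: continuous_re_norm.
by apply: (@continuousB (scalars R s) (scalars R s) (prod_topology K));
  exact: continuous_prod_eval.
Qed.

Lemma prod_dist_powR_bounded p T S : 0 < p ->
  exists M, forall phi, `|prod_dist_powR p T S phi| <= M.
Proof.
move=> p0.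
have : compact (prod_dist_powR p T S @` [set: prod_topology K]).
  apply: continuous_compact; last exact: compact_prod_topology.
  by apply: continuous_subspaceT; exact: continuous_prod_dist_powR.
move=> /compact_bounded[M [_ /(_ (M + 1))]]; rewrite ltrDl ltr01 => /(_ isT) fM.
by exists (M + 1) => phi; apply: fM; exists phi.
Qed.

End products_topology.

(** * Semi-integrability and domination by an integral *)

Section domination.
Context (R : realType) (s : scalar_kind) (m : nat) (K : 'I_m -> compactHausdorffType).
Context (H : forall i, submodClosed (cfun R s (K i))).
Context (F : normedModType (scalars R s)) (p : R) (p1 : 1 <= p).
Variable u : (forall i, subvec (H i)) -> F.

Let p0 : 0 < p. Proof. exact: lt_le_trans p1. Qed.

Let powRVK (a : R) : 0 <= a -> (a `^ p^-1) `^ p = a.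
Proof. by move=> a0; rewrite -powRrM mulVf ?gt_eqF// powRr1. Qed.

Let powRKV (a : R) : 0 <= a -> (a `^ p) `^ p^-1 = a.
Proof. by move=> a0; rewrite -powRrM divff ?gt_eqF// powRr1. Qed.

Let powR_le (a b : R) : 0 <= a -> a <= b -> a `^ p <= b `^ p.
Proof.
by move=> a0 ab; apply: ge0_ler_powR => //; rewrite ?nnegrE ?(ltW p0)// (le_trans a0).
Qed.

Let powRV_le (a b : R) : 0 <= a -> a <= b -> a `^ p^-1 <= b `^ p^-1.
Proof.
move=> a0 ab; apply: ge0_ler_powR => //;
  by rewrite ?nnegrE ?invr_ge0 ?(ltW p0)// (le_trans a0).
Qed.

(** Evaluations lie in the dual balls, so the supremum bounds the sum at every [phi]; integrating
    against the probability [nu] keeps the bound. *)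
Lemma dominated_lipschitz_semi_integral (C : R)
    (nu : probability (borel (prod_topology K)) R) :
  0 < C ->
  (forall T S, ((re `|u T - u S|)%:E <=
    C%:E * (\int[nu]_phi (prod_dist_powR p T S phi)%:E) `^ p^-1)%E) ->
  lipschitz_semi_integral p u.
Proof.
move=> C0 uC; exists C => // n x q.
set E := ereal_sup _.
pose g j := prod_dist_powR p (x j) (q j).
have g0 j phi : 0 <= g j phi by exact: powR_ge0.
have sg0 phi : 0 <= \sum_j g j phi by apply: sumr_ge0.
have evE phi : (((\sum_j g j phi) `^ p^-1)%:E <= E)%E.
  apply: ereal_sup_ubound.
  exists (fun i => evaluation (H := H i) (phi i) : {linear _ -> _}) => //.
  by move=> i; exact: dual_ball_evaluation.
(* If [E] is [+oo] the claim is trivial as [0 < C]; it is not [-oo], since the product space has a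
   point. *)
clearbody E; case: E evE => [r| |] evE; last 2 first.
  by rewrite gt0_muley ?lte_fin// leey.
  by have := evE (fun=> point); rewrite leeNy_eq.
have sgr phi : \sum_j g j phi <= r `^ p.
  rewrite -[leLHS]powRVK//; apply: powR_le; first exact: powR_ge0.
  by rewrite -lee_fin evE.
have mg j : measurable_fun setT (fun phi : borel (prod_topology K) => (g j phi)%:E).
  apply/measurable_EFinP; apply: continuous_borel_measurable.
  exact: continuous_prod_dist_powR.
have intg : (\sum_j \int[nu]_phi (g j phi)%:E <= (r `^ p)%:E)%E.
  rewrite -ge0_integral_sum//; last by move=> j phi _; rewrite lee_fin.
  apply: (@le_trans _ _ (\int[nu]_phi (cst (r `^ p)%:E phi))%E).
    apply: ge0_le_integral => //.
    - by move=> phi _; apply: sume_ge0 => j _; rewrite lee_fin.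
    - exact: emeasurable_sum.
    - by move=> phi _; rewrite sumEFin lee_fin.
  by rewrite integral_cst//= (@probability_setT _ _ _ nu) mule1.
have intg0 j : (0 <= \int[nu]_phi (g j phi)%:E)%E.
  by apply: integral_ge0 => phi _; rewrite lee_fin.
have intgfin j : (\int[nu]_phi (g j phi)%:E)%E \is a fin_num.
  rewrite ge0_fin_numE//; apply: (@le_lt_trans _ _ (r `^ p)%:E); last exact: ltry.
  apply: le_trans intg; rewrite (bigD1 j)//= leeDl//.
  by apply: sume_ge0.
pose I j := fine (\int[nu]_phi (g j phi)%:E)%E.
have I0 j : 0 <= I j by exact: fine_ge0.
have sI : \sum_j I j <= r `^ p.
  by rewrite -lee_fin -sumEFin; under eq_bigr do rewrite /I fineK//.
have r0 : 0 <= r.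
  by rewrite -lee_fin (le_trans _ (evE (fun=> point)))// lee_fin powR_ge0.
have cI j : re `|u (x j) - u (q j)| `^ p <= C `^ p * I j.
  rewrite -[I j]powRVK// -powRM ?powR_ge0// ?(ltW C0)//.
  apply: powR_le; first exact: re_norm_ge0.
  by rewrite -lee_fin EFinM -poweR_EFin /I fineK//; exact: uC.
rewrite -EFinM lee_fin.
have -> : C * r = (C `^ p * r `^ p) `^ p^-1.
  by rewrite -powRM ?(ltW C0)// powRKV// mulr_ge0// ltW.
apply: powRV_le; first by apply: sumr_ge0 => j _; exact: powR_ge0.
apply: le_trans (ler_sum _ (fun j _ => cI j)) _.
by rewrite -mulr_sumr ler_wpM2l// powR_ge0.
Qed.

Hypothesis u_multilinear : multilinear u.

Lemma multilinear_dfwith0 (z : forall i, subvec (H i)) (i : 'I_m) : u (dfwith z i 0) = 0.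
Proof.
have := @u_multilinear z i 1 0 0; rewrite !scale1r addr0 => /eqP.
by rewrite -subr_eq0 opprD addNKr oppr_eq0 => /eqP.
Qed.

Lemma multilinear_dfwithZ (z : forall i, subvec (H i)) (i : 'I_m) a :
  u (dfwith z i (a *: z i)) = a *: u z.
Proof.
have := @u_multilinear z i a (z i) 0; rewrite addr0 multilinear_dfwith0 addr0 => ->.
by congr (_ *: u _); apply/functional_extensionality_dep => j; case: dfwithP.
Qed.

(* For [m = 0] all families are equal, hence both sides vanish. *)
Lemma prod_dist_powR_scale (a : R) T S : 0 <= a -> exists T' S',
  (forall phi, prod_dist_powR p T' S' phi = a * prod_dist_powR p T S phi) /\
  re `|u T' - u S'| `^ p = a * re `|u T - u S| `^ p.
Proof.
move=> a0; have [i0 _|I0] := pickP (fun _ : 'I_m => true); last first.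
  have -> : T = S by apply/functional_extensionality_dep => i; have := I0 i.
  have re0 (V : normedModType (scalars R s)) (v : V) : re `|v - v| `^ p = 0.
    by rewrite subrr normr0 -of_real0 of_realK powR0// gt_eqF.
  by exists S, S; split=> [phi|]; rewrite /prod_dist_powR ?re0 mulr0.
(* Scaling one coordinate by [b] scales both the product and [u] by [b], hence both p-th powers by
   [a]. *)
pose b := a `^ p^-1.
have b0 : 0 <= b by exact: powR_ge0.
pose sc (z : forall i, subvec (H i)) := dfwith z i0 (of_real s b *: z i0).
have reb (V : normedModType (scalars R s)) (v w : V) :
    re `|of_real s b *: v - of_real s b *: w| `^ p = a * re `|v - w| `^ p.
  rewrite -scalerBr re_normZ re_norm_of_real// powRM ?re_norm_ge0//.
  by rewrite powRVK.
have prod_sc z phi : \prod_i subvec_val (sc z i) (phi i) =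
    of_real s b * \prod_i subvec_val (z i) (phi i).
  rewrite (bigD1 i0)//= [in RHS](bigD1 i0)//= /sc dfwithin subvecZE mulrA.
  by congr (_ * _); apply: eq_bigr => i ii0; rewrite dfwithout// eq_sym.
exists (sc T), (sc S); split=> [phi|]; last by rewrite /sc !multilinear_dfwithZ reb.
by rewrite /prod_dist_powR !prod_sc; exact: reb.
Qed.

(** The cone collects all finite families at once, so that one measure serves every pair; the
    constant [C] is kept. *)
Lemma lipschitz_semi_integral_dominated : lipschitz_semi_integral p u ->
  exists (C : R) (nu : probability (borel (prod_topology K)) R),
    [/\ 0 < C, regular_measure nu & forall T S, ((re `|u T - u S|)%:E <=
    C%:E * (\int[nu]_phi (prod_dist_powR p T S phi)%:E) `^ p^-1)%E].
Proof.
move=> [C C0 uC].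
pose TS := ((forall i, subvec (H i)) * (forall i, subvec (H i)))%type.
pose g (t : TS) : bfun R (prod_topology K) :=
  mk_bfun (prod_dist_powR_bounded t.1 t.2 p0).
pose c (t : TS) := re `|u t.1 - u t.2| `^ p.
pose h (t : TS) := C `^ p *: g t - c t *: bindic R setT.
(* Lists make this a cone: concatenation adds, and [prod_dist_powR_scale] absorbs nonnegative
   factors into the pairs. *)
pose D := [set \sum_(t <- r) h t | r in [set: seq TS]].
have Cp0 : 0 < C `^ p by exact: powR_gt0.
have D0 : D 0 by exists [::] => //; rewrite big_nil.
have DD d d' : D d -> D d' -> D (d + d').
  by move=> [r _ <-] [r' _ <-]; exists (r ++ r') => //; rewrite big_cat.
have DZ a d : 0 <= a -> D d -> D (a *: d).
  move=> a0 [r _ <-]; elim: r => [|t r [r' _ IH]].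
    by exists [::] => //; rewrite !big_nil scaler0.
  have [T' [S' [gE cE]]] := prod_dist_powR_scale t.1 t.2 a0.
  exists ((T', S') :: r') => //; rewrite !big_cons IH scalerDr; congr (_ + _).
  have -> : h (T', S') = C `^ p *: g (T', S') - c (T', S') *: bindic R setT by [].
  have -> : g (T', S') = a *: g t by apply/val_inj/funext => phi; exact: gE.
  by rewrite /h scalerBr !scalerA /c cE [C `^ p * a]mulrC.
have hE t phi : h t phi = C `^ p * g t phi - c t.
  transitivity (C `^ p * g t phi - c t * \1_setT phi); first exact: erefl.
  by rewrite indicE in_setT mulr1.
have Dge d e : D d -> 0 < e -> exists x, - e <= d x.
  move=> [r _ <-] e0; apply: contrapT => /forallNP dlt.
  (* If [d < - e] everywhere, the sum of the [g t] is at most [M] at every point. Semi-integrability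
     on the listed pairs then bounds the sum of the [c t] by itself minus [e], a contradiction. *)
  pose M := (\sum_(t <- r) c t - e) / C `^ p.
  have gM phi : \sum_(t <- r) g t phi <= M.
    have /negP := dlt phi; rewrite -ltNge bfun_sumE (eq_bigr _ (fun t _ => hE t phi)).
    rewrite sumrB -mulr_sumr => /ltW.
    by rewrite lerBlDr addrC ler_pdivlMr// mulrC.
  pose x (j : 'I_(size r)) := (tnth (in_tuple r) j).1.
  pose q (j : 'I_(size r)) := (tnth (in_tuple r) j).2.
  have M0 : 0 <= M.
    by apply: le_trans (gM (fun=> point)); apply: sumr_ge0 => t _; exact: powR_ge0.
  have := uC _ x q; set E := ereal_sup _.
  have EM : (E <= (M `^ p^-1)%:E)%E.
    apply: ge_ereal_sup => _ [a a1 <-]; rewrite lee_fin; apply: powRV_le.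
      by apply: sumr_ge0 => j _; exact: powR_ge0.
    apply: dual_ball_sum_prod_le => // phi.
    by apply: le_trans (gM phi); rewrite [leRHS]big_tnth.
  rewrite leNgt => /negP; apply.
  apply: (@le_lt_trans _ _ (C%:E * (M `^ p^-1)%:E)%E).
    by rewrite lee_pmul2l// ?lte_fin.
  have -> : \sum_(j < size r) re `|u (x j) - u (q j)| `^ p = \sum_(t <- r) c t.
    by rewrite [RHS]big_tnth.
  have CM : C `^ p * M = \sum_(t <- r) c t - e by rewrite /M mulrC divfK// gt_eqF.
  have CM0 : 0 <= \sum_(t <- r) c t - e by rewrite -CM mulr_ge0// ltW.
  rewrite -EFinM lte_fin -{1}[C]powRKV ?(ltW C0)// -powRM// ?powR_ge0// CM.
  rewrite gt0_ltr_powR ?invr_gt0 ?nnegrE//; last by rewrite gtrBl.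
  by rewrite (le_trans CM0)// gerBl ltW.
have [nu nureg nuD] := exists_dominating_measure (@compact_prod_topology m K)
  (@hausdorff_prod_topology m K) D0 DD DZ Dge.
exists C, nu; split=> // T S.
have Cg phi : (C `^ p *: g (T, S)) phi = C `^ p * prod_dist_powR p T S phi.
  exact: erefl.
have cg : continuous (C `^ p *: g (T, S) : prod_topology K -> R).
  move=> phi; apply: (@continuousM _ (prod_topology K)); first exact: cst_continuous.
  exact: continuous_prod_dist_powR.
have Cg0 phi : 0 <= (C `^ p *: g (T, S)) phi.
  by rewrite Cg mulr_ge0 ?prod_dist_powR_ge0// ltW.
have D1 : D (C `^ p *: g (T, S) - c (T, S) *: bindic R setT).
  by exists [:: (T, S)] => //; rewrite big_seq1.
have := nuD _ _ cg Cg0 D1.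
under eq_integral do rewrite Cg EFinM.
have mg : measurable_fun setT
    (fun phi : borel (prod_topology K) => (prod_dist_powR p T S phi)%:E).
  apply/measurable_EFinP; apply: continuous_borel_measurable.
  exact: continuous_prod_dist_powR.
rewrite ge0_integralZl ?lee_fin ?(ltW Cp0)//; last first.
  by move=> phi _; rewrite lee_fin prod_dist_powR_ge0.
have : (0 <= \int[nu]_phi (prod_dist_powR p T S phi)%:E)%E.
  by apply: integral_ge0 => phi _; rewrite lee_fin prod_dist_powR_ge0.
(* An infinite integral makes the right side [+oo]; [-oo] is excluded by nonnegativity. *)
case: (\int[nu]_phi (prod_dist_powR p T S phi)%:E)%E => [r| |] //; last first.
  by move=> _ _; rewrite poweRyr ?gt_eqF ?invr_gt0// gt0_muley ?lte_fin// leey.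
rewrite lee_fin => r0; rewrite -EFinM lee_fin => cr.
rewrite poweR_EFin -EFinM lee_fin -[leLHS]powRKV ?re_norm_ge0//.
rewrite -[C]powRKV ?(ltW C0)// -powRM ?powR_ge0//.
by apply: powRV_le => //; exact: powR_ge0.
Qed.

End domination.

Theorem theorem5p1 (R : realType) (s : scalar_kind) (m : nat)
    (K : 'I_m -> compactHausdorffType)
    (H : forall i, submodClosed (cfun R s (K i)))
    (Hclosed : forall i, closed [set f : cfun R s (K i) | f \in H i])
    (F : completeNormedModType (scalars R s))
    (p : R) (p1 : 1 <= p)
    (u : (forall i, subvec (H i)) -> F)
    (u_multilinear : multilinear u)
    (u_continuous :
      continuous (u : prod_topology (fun i => subvec (H i)) -> F)) :
  lipschitz_semi_integral p u <->
  exists (C : R) (nu : probability (borel (prod_topology K)) R),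
    [/\ 0 < C, regular_measure nu &
      forall T S : forall i, subvec (H i),
        ((re `|u T - u S|)%:E <=
         C%:E * (\int[nu]_phi
           ((re `|\prod_i subvec_val (T i) (phi i) -
                  \prod_i subvec_val (S i) (phi i)|) `^ p)%:E)
             `^ p^-1)%E].
Proof.
split; first exact: lipschitz_semi_integral_dominated.
by move=> [C [nu [C0 _ uC]]]; exact: dominated_lipschitz_semi_integral C0 uC.
Qed.
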